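(* Let $p$ be an odd prime, $a=\prod_{i=1}^m q_i^{e_i}$ with $m\ge1$, distinct primes $q_1,\dots,q_m$ and $1\le e_i\le p-1$, let $\alpha=\sqrt[p]{a}$, $K=\mathbb{Q}(\alpha)$, with ring of integers $\mathcal{O}_K$. Let $u_i,v_i$ be as in the context. If $\mathbb{Z}[\alpha]$ is $p$-maximal and all exponents $e_i$ of the prime decomposition of $a$ which are not divisible by $p$ are congruent to each other modulo $p$, then $K$ is monogenic with $$\mathcal{O}_K=\mathbb{Z}\left[\frac{\alpha^{u_1}}{\prod_{i=1}^m q_i^{v_i}}\right].$$
   Context: The polynomial $X^p-a$ is irreducible over $\mathbb{Z}$. A subring $\mathcal{O}\subseteq\mathcal{O}_K$ is $q$-maximal ($q$ a prime) if the index $[\mathcal{O}_K:\mathcal{O}]$ is not divisible by $q$. For $1\le i\le m$, $u_i,v_i$ are the integers with $1\le u_i\le p-1$, $v_i\ge0$ and $e_iu_i-pv_i=1$. A number field $L$ of degree $n$ is monogenic if there is $\vartheta\in\mathcal{O}_L$ such that $\{1,\vartheta,\dots,\vartheta^{n-1}\}$ is a $\mathbb{Z}$-basis of $\mathcal{O}_L$. *)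

(* Defs.v *)
From HB Require Import structures.
From mathcomp Require Import all_boot all_order all_algebra all_field.

Set Implicit Arguments.
Unset Strict Implicit.
Unset Printing Implicit Defensive.

Import GRing.Theory Num.Theory.
Local Open Scope ring_scope.

(* A number field is a [K : fieldExtType rat]; subsets of [K] are [K -> Prop]. *)

Definition ring_of_integers (K : fieldExtType rat) (x : K) : Prop :=
  integralOver (intr : int -> K) x.

(* Z[t] *)
Definition Zadjoin (K : fieldExtType rat) (t x : K) : Prop :=
  exists f : {poly int}, x = (map_poly (intr : int -> K) f).[t].

(* [A : B] = n, for additive subgroups B <= A of K: [r] is a complete,
   irredundant family of representatives of A modulo B. *)
Definition has_index (K : fieldExtType rat) (A B : K -> Prop) (n : nat) : Prop :=
  exists r : 'I_n -> K,
    (forall i, A (r i)) /\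
    (forall x, A x -> exists! i : 'I_n, B (x - r i)).

(* Meant for subrings O of the ring of integers; the index is required to be
   finite, so that its divisibility by q makes sense. *)
Definition q_maximal (K : fieldExtType rat) (q : nat) (O : K -> Prop) : Prop :=
  exists2 n : nat, has_index (@ring_of_integers K) O n & ~~ (q %| n)%N.

Definition is_Zbasis (K : fieldExtType rat) (n : nat) (b : 'I_n -> K)
    (A : K -> Prop) : Prop :=
  (forall x, A x <-> exists c : 'I_n -> int, x = \sum_(i < n) b i *~ c i) /\
  (forall c : 'I_n -> int, \sum_(i < n) b i *~ c i = 0 -> forall i, c i = 0).

Definition monogenic (K : fieldExtType rat) : Prop :=
  exists2 t : K, ring_of_integers t &
    is_Zbasis (fun i : 'I_(\dim {:K}) => t ^+ i) (@ring_of_integers K).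

(* Main.v *)
(* The bounds on the exponents force all e_i to be equal, hence all u_i and all
   v_i.  So beta = alpha^u / N^v, with N the product of the q_i, satisfies
   beta^p = N and beta^e = alpha, and Z[alpha] <= Z[beta] <= O_K.
   Let x = sum_i c_i beta^i be integral, with rational c_i.  Its conjugates in
   the algebraic numbers are x_j = sum_k c_k w^(jk) z^k with w a primitive p-th
   root of unity and z^p = N, so p c_i z^i = sum_j w^(-ij) x_j is an algebraic
   integer; taking p-th powers, (p c_i)^p N^i is an integer, and as N is
   squarefree and i < p, so is p c_i.  On the other hand n c_i is an integer
   for n = [O_K : Z[alpha]], which is prime to p; hence c_i is an integer. *)

Require Import Defs.
From HB Require Import structures.
From mathcomp Require Import all_boot all_order all_algebra all_field.
From mathcomp Require Import zify ring.

Set Implicit Arguments.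
Unset Strict Implicit.
Unset Printing Implicit Defensive.

Import GRing.Theory Num.Theory.
Local Open Scope ring_scope.

(** * Squarefree integers: irreducibility and integrality of rational coefficients *)

Definition squarefree (N : nat) := forall l, prime l -> ~~ (l ^ 2 %| N)%N.

(** Eisenstein's criterion at a prime divisor [l] of [N]: the constant term is divisible by [l] but
    not by [l ^ 2]. *)
Lemma irreducible_XnsubC (p N : nat) : (0 < p)%N -> (1 < N)%N ->
  squarefree N -> irreducible_poly ('X^p - N%:R%:P : {poly rat}).
Proof.
move=> p_gt0 N_gt1 sqfN.
have -> : 'X^p - N%:R%:P = map_poly intr ('X^p - N%:R%:P) :> {poly rat}.
  by rewrite rmorphB /= map_polyXn map_polyC /= natz.
have l_pr := pdiv_prime N_gt1.
apply/irreducible_rat_int/(eisenstein_crit l_pr); rewrite ?size_XnsubC //.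
- by rewrite eqSS -lt0n.
- rewrite (monicP (monicXnsubC _ p_gt0)).
  by rewrite dvdzE /= dvdn1 neq_ltn prime_gt1 ?orbT.
- rewrite coefB coefXn coefC eqxx eq_sym -[(p == 0)%N]negbK -lt0n p_gt0 sub0r.
  by rewrite dvdzE abszN natz /= sqfN.
move=> i /= ltip; rewrite coefB coefXn ltn_eqF // sub0r coefC.
case: eqP => _; last by rewrite oppr0 dvdz0.
by rewrite dvdzE abszN natz /= pdiv_dvd.
Qed.

(** The common root [x] makes [gcdp P f] nonconstant, so by irreducibility this divisor of [P] is
    associate to [P]. *)
Lemma irredp_dvdp_root (F L : fieldType) (iota : {rmorphism F -> L})
    (P f : {poly F}) (x : L) :
  irreducible_poly P -> root (map_poly iota P) x -> root (map_poly iota f) x ->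
  P %| f.
Proof.
move=> irrP Px fx.
have := irredp_XsubCP irrP (dvdp_gcdl P f) => -[g1|].
  have : root (map_poly iota (gcdp P f)) x.
    by rewrite gcdp_map root_gcd Px fx.
  move: g1; rewrite -(eqp_map iota) => /eqp_root ->.
  by rewrite rmorph1 (negPf (root1 _)).
by move=> gP; rewrite -(eqp_dvdl _ gP) dvdp_gcdr.
Qed.

(** The [p]-th power [c ^+ p * N ^+ i] is a rational algebraic integer, hence an integer. A prime
    [l] in the denominator of [c] would give [l ^ p] dividing [N ^ i], while [N] contains [l] at
    most once and [i < p]. *)
Lemma rat_int_of_pow_Aint (p N i : nat) (z : algC) (c : rat) :
  squarefree N -> (0 < N)%N -> (i < p)%N -> z ^+ p = N%:R ->
  ratr c * z ^+ i \in Aint -> c \is a Num.int.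
Proof.
move=> sqfN N_gt0 ltip zp Aczi.
have /intrP[k Dk] : (ratr (c ^+ p * N%:R ^+ i) : algC) \in Num.int.
  apply: Cint_rat_Aint; first exact: Crat_rat.
  rewrite rmorphM !rmorphXn /= rmorph_nat -zp -exprM mulnC exprM -exprMn.
  exact: rpredX.
have {}Dk : c ^+ p * N%:R ^+ i = k%:~R.
  apply: (fmorph_inj (ratr : {rmorphism rat -> algC})).
  by rewrite /= ratr_int.
have : (numq c) ^+ p * N%:Z ^+ i = k * denq c ^+ p.
  apply: (@intr_inj rat); rewrite !rmorphM !rmorphXn /= numqE exprMn.
  by rewrite mulrAC -Dk -pmulrn.
move/(congr1 absz); rewrite !abszM !abszX /= => Dnat.
have den_dvd : (`|denq c| ^ p %| N ^ i)%N.
  rewrite -(@Gauss_dvdr _ (`|numq c| ^ p)%N).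
    by rewrite Dnat dvdn_mull.
  by rewrite coprimeXl // coprimeXr // coprime_sym coprime_num_den.
rewrite Qint_def; have den_gt0 : (0 < `|denq c|)%N by rewrite absz_gt0 denq_neq0.
case: (leqP `|denq c| 1) => [le1|/pdiv_prime l_pr].
  by have := denq_gt0 c; move: den_gt0 le1; lia.
set l := pdiv _ in l_pr.
have le1 : (logn l N <= 1)%N.
  by rewrite leqNgt -pfactor_dvdn //; apply: sqfN.
have ge1 : (1 <= logn l `|denq c|)%N by rewrite -pfactor_dvdn // pdiv_dvd.
have := dvdn_leq_log l _ den_dvd; rewrite expn_gt0 N_gt0 => /(_ isT).
by rewrite !lognX; nia.
Qed.

(** * Fourier inversion over the roots of unity *)

Lemma sum_prim_root_exp (p k : nat) (w : algC) : p.-primitive_root w ->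
  \sum_(j < p) w ^+ (j * k) = if (p %| k)%N then p%:R else 0.
Proof.
move=> w_prim; under eq_bigr do rewrite mulnC exprM.
case: ifP => pk.
  move: pk; rewrite (prim_order_dvd w_prim) => /eqP->.
  by under eq_bigr do rewrite expr1n; rewrite sumr_const card_ord.
(* Multiplying by the nonzero [w ^+ k - 1] telescopes the geometric sum to [w ^+ (k * p) - 1], which
   vanishes. *)
apply/eqP; move/negbT: pk; rewrite (prim_order_dvd w_prim) -subr_eq0 => /mulfI.
move/inj_eq=> <-; rewrite -subrX1 mulr0 exprAC (prim_expr_order w_prim).
by rewrite expr1n subrr.
Qed.

Lemma Aint_coef_of_conjugates (p i : nat) (w z : algC) (f : {poly algC}) :
  p.-primitive_root w -> (size f <= p)%N -> (i < p)%N ->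
  (forall j, f.[w ^+ j * z] \in Aint) -> p%:R * f`_i * z ^+ i \in Aint.
Proof.
move=> w_prim szf ltip Af.
(* The exponent [p - i] stands for [-i], since [w ^+ p = 1]. *)
suff <- : \sum_(j < p) w ^+ (j * (p - i)) * f.[w ^+ j * z]
          = p%:R * f`_i * z ^+ i.
  apply: rpred_sum => j _; apply: rpredM => //.
  exact/rpredX/(Aint_prim_root w_prim).
under eq_bigr do rewrite (horner_coef_wide _ szf) mulr_sumr.
have term (k : nat) :
    \sum_(j < p) w ^+ (j * (p - i)) * (f`_k * (w ^+ j * z) ^+ k)
    = f`_k * z ^+ k * \sum_(j < p) w ^+ (j * (p - i + k)).
  rewrite mulr_sumr; apply: eq_bigr => j _.
  by rewrite mulnDr exprD exprMn -exprM; ring.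
rewrite exchange_big /= (bigD1 (Ordinal ltip)) //= [X in _ + X]big1 => [|k ki].
  rewrite addr0 term (sum_prim_root_exp _ w_prim) subnK ?(ltnW ltip) //.
  by rewrite dvdnn; ring.
rewrite term (sum_prim_root_exp _ w_prim) ifN ?mulr0 //.
(* As [p - i + k] lies strictly between [0] and [2p], the only multiple of [p] it can be is [p]
   itself, which forces [k = i]. *)
apply: contra ki => /dvdnP[t Dt]; rewrite -val_eqE /=.
by have := ltn_ord k; case: t Dt => [|[|t]] Dt; nia.
Qed.

(* Translation by [x] permutes the cosets of [B] in [A]; summing the
   representatives before and after gives Lagrange's theorem. *)
Lemma has_index_mulrn (K : fieldExtType rat) (A B : K -> Prop) (n : nat) x :
  (forall y z, A y -> A z -> A (y + z)) ->
  (forall y z, B y -> B z -> B (y - z)) ->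
  has_index A B n -> A x -> B (x *+ n).
Proof.
move=> A_add B_sub [r [Ar r_uniq]] Ax.
have Bdec i : exists j, B (r i + x - r j).
  by have [j [Bj _]] := r_uniq _ (A_add _ _ (Ar i) Ax); exists j.
have [s Bs] := fin_all_exists Bdec.
have B0 : B 0.
  have [j [Bj _]] := r_uniq _ Ax.
  by rewrite -(subrr (x - r j)); apply: B_sub.
have B_add y z : B y -> B z -> B (y + z).
  by move=> By Bz; rewrite -(opprK z) -(sub0r z); apply/B_sub/B_sub.
(* If translation sends [r i] and [r k] to the same coset, then [r i - r k] is in [B], and both
   indices represent [r i]. *)
have s_inj : injective s.
  move=> i k sik; have [j [_ j_uniq]] := r_uniq _ (Ar i).
  rewrite -(j_uniq i) ?subrr //; apply: j_uniq.
  have -> : r i - r k = (r i + x - r (s i)) - (r k + x - r (s k)).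
    by rewrite sik; ring.
  exact: B_sub.
have : B (\sum_i (r i + x - r (s i))) by apply: big_ind.
rewrite sumrB big_split /= sumr_const card_ord.
by rewrite [X in X + _ - _](reindex_inj s_inj) /= addrAC subrr add0r.
Qed.

(** * The field generated by a [p]-th root of a squarefree integer *)

Section PureField.

Variables (K : fieldExtType rat) (p N : nat) (beta : K).
Hypotheses (p_gt0 : (0 < p)%N) (N_gt1 : (1 < N)%N) (sqfN : squarefree N).
Hypothesis beta_root : beta ^+ p = N%:R.
Hypothesis beta_gen : <<1; beta>>%VS = {:K}%VS.

Let P : {poly rat} := 'X^p - N%:R%:P.

Let irrP : irreducible_poly P.
Proof. exact: irreducible_XnsubC. Qed.

Let Pbeta : root (map_poly (in_alg K) P) beta.
Proof.
rewrite rmorphB /= map_polyXn map_polyC /= scaler_nat rootE !hornerE beta_root.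
by rewrite subrr.
Qed.

(** Linear independence of the first [p] powers of [beta]: the irreducible [P], of degree [p],
    divides every rational polynomial vanishing at [beta]. *)
Lemma size_root_eq0 (f : {poly rat}) : (size f <= p)%N ->
  (map_poly (in_alg K) f).[beta] = 0 -> f = 0.
Proof.
move=> szf /rootP/(irredp_dvdp_root irrP Pbeta) dvdPf; apply/eqP.
apply: contraLR szf => f_neq0; rewrite -ltnNge.
by have := dvdp_leq f_neq0 dvdPf; rewrite size_XnsubC.
Qed.

Lemma dim_pure : \dim {:K} = p.
Proof.
rewrite -beta_gen dim_Fadjoin dimv1 muln1; apply/eqP; rewrite -eqSS -size_minPoly.
rewrite eqn_leq; apply/andP; split.
  rewrite -(size_XnsubC (N%:R : K) p_gt0); apply: dvdp_leq.
    by rewrite monic_neq0 ?monicXnsubC.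
  apply: minPoly_dvdp; last by rewrite rootE !hornerE beta_root subrr.
  by rewrite rpredB ?rpredX ?polyOverX ?polyOverC ?rpred_nat.
(* For the other inequality, the minimal polynomial comes from a rational polynomial [g], which [P]
   divides. *)
have /polyOver1P[g Dg] := minPolyOver 1 beta.
have := root_minPoly 1 beta; rewrite Dg size_map_poly => gbeta.
rewrite -(size_XnsubC (N%:R : rat) p_gt0); apply: dvdp_leq.
  by rewrite -(map_poly_eq0 (in_alg K)) -Dg monic_neq0 ?monic_minPoly.
exact: (irredp_dvdp_root irrP Pbeta).
Qed.

Lemma pure_polyP (x : K) : exists2 f : {poly rat},
  (size f <= p)%N & x = (map_poly (in_alg K) f).[beta].
Proof.
have := Fadjoin_polyOver 1 beta x => /polyOver1P[f Df].
exists f; last by rewrite -Df Fadjoin_poly_eq // beta_gen memvf.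
rewrite -(size_map_poly (in_alg K)) -Df -[leqRHS]dim_pure -beta_gen dim_Fadjoin.
by rewrite dimv1 muln1 size_Fadjoin_poly.
Qed.

Lemma map_in_alg_intr (h : {poly int}) :
  map_poly (in_alg K) (map_poly intr h) = map_poly intr h.
Proof.
by rewrite -map_poly_comp; apply: eq_map_poly => a /=; rewrite scaler_int.
Qed.

Lemma Zadjoin_pure_small (x : K) : Zadjoin beta x ->
  exists2 h : {poly int}, (size h <= p)%N & x = (map_poly intr h).[beta].
Proof.
(* Division by the monic [d] stays over the integers, and the remainder has the same value at
   [beta]. *)
case=> f ->; pose d : {poly int} := 'X^p - N%:R%:P.
have d_monic : d \is monic by apply: monicXnsubC.
exists (Pdiv.CommonRing.rmodp f d).
  rewrite -ltnS -(size_XnsubC (N%:R : int) p_gt0).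
  exact/Pdiv.CommonRing.ltn_rmodpN0/monic_neq0.
rewrite {1}(Pdiv.RingMonic.rdivp_eq d_monic f) rmorphD rmorphM /= hornerD hornerM.
rewrite rmorphB /= map_polyXn map_polyC /= rmorph_nat !hornerE beta_root.
by rewrite subrr mulr0 add0r.
Qed.

Lemma integral_pure : ring_of_integers beta.
Proof.
exists ('X^p - N%:R%:P); first exact: monicXnsubC.
rewrite rmorphB /= map_polyXn map_polyC /= rmorph_nat rootE !hornerE beta_root.
by rewrite subrr.
Qed.

Lemma Zadjoin_integral (t x : K) :
  ring_of_integers t -> Zadjoin t x -> ring_of_integers x.
Proof.
move=> t_int [f ->]; apply: integral_horner t_int; apply/integral_poly => i.
by rewrite coef_map; apply: integral_id.
Qed.

(** An integral equation [g] for [f(beta)] makes [P] divide [g \Po f], so [g] also kills the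
    conjugate [f(y)], for any root [y] of [P] in [algC]. *)
Lemma Aint_conjugate (iota : {rmorphism rat -> algC}) (f : {poly rat}) y :
  y ^+ p = N%:R -> ring_of_integers (map_poly (in_alg K) f).[beta] ->
  (map_poly iota f).[y] \in Aint.
Proof.
move=> yp [g g_monic g_root]; have Py : (map_poly iota P).[y] = 0.
  by rewrite rmorphB /= map_polyXn map_polyC /= rmorph_nat !hornerE yp subrr.
have /dvdpP[s Dg] : P %| map_poly intr g \Po f.
  apply: (irredp_dvdp_root irrP Pbeta); move: g_root.
  by rewrite !rootE map_comp_poly horner_comp map_in_alg_intr.
apply: (@root_monic_Aint (map_poly intr g)).
- have -> : map_poly intr g = map_poly iota (map_poly intr g) :> {poly algC}.
    by rewrite -map_poly_comp; apply: eq_map_poly => k /=; rewrite rmorph_int.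
  by rewrite rootE -horner_comp -map_comp_poly Dg rmorphM hornerM Py mulr0.
- exact: monic_map.
by apply/polyOverP => k; rewrite coef_map /= intr_int.
Qed.

Lemma pure_coef_intM (f : {poly rat}) i : (size f <= p)%N ->
  ring_of_integers (map_poly (in_alg K) f).[beta] ->
  p%:R * f`_i \is a Num.int.
Proof.
move=> szf x_int; have [lepi|ltip] := leqP p i.
  by rewrite nth_default ?mulr0 ?rpred0 ?(leq_trans szf).
have [w w_prim] := C_prim_root_exists p_gt0.
pose z : algC := p.-root N%:R.
have zp : z ^+ p = N%:R by apply: rootCK.
apply: (rat_int_of_pow_Aint sqfN (ltnW N_gt1) ltip zp).
rewrite rmorphM /= rmorph_nat -(coef_map (ratr : {rmorphism rat -> algC})).
apply: (Aint_coef_of_conjugates w_prim) => // [|j].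
  by rewrite size_map_poly.
apply: Aint_conjugate x_int.
by rewrite exprMn exprAC (prim_expr_order w_prim) expr1n mul1r zp.
Qed.

Lemma integral_pureP (n : nat) : coprime n p ->
  (forall x, ring_of_integers x -> Zadjoin beta (x *+ n)) ->
  forall x, ring_of_integers x <-> Zadjoin beta x.
Proof.
move=> co_np Zn x; split; last by apply: Zadjoin_integral; apply: integral_pure.
move=> x_int; have [f szf Dx] := pure_polyP x.
have [h szh Dh] := Zadjoin_pure_small (Zn x x_int).
have fn_int i : n%:R * f`_i \is a Num.int.
  (* Both [n%:R *: f] and [h] express [x *+ n] in the first [p] powers of [beta], so independence
     identifies their coefficients. *)
  suff /(congr1 (fun g : {poly rat} => g`_i))/eqP :
      n%:R *: f - map_poly intr h = 0.
    by rewrite coefB coefZ coef0 subr_eq0 coef_map => /eqP->; apply: intr_int.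
  apply: size_root_eq0.
    rewrite (leq_trans (size_polyD _ _)) // size_polyN geq_max.
    by rewrite (leq_trans (size_scale_leq _ _)) // (leq_trans (size_poly _ _)).
  rewrite rmorphB /= map_in_alg_intr map_polyZ /= hornerD hornerN hornerZ -Dx -Dh.
  by rewrite scaler_nat mulr_natl subrr.
have f_int i : f`_i \is a Num.int.
  have /coprimezP[[s t] /= st1] : coprimez n%:Z p%:Z by [].
  have -> : f`_i = s%:~R * (n%:R * f`_i) + t%:~R * (p%:R * f`_i).
    rewrite !mulrA -mulrDl [n%:R]pmulrn [p%:R]pmulrn -!intrM -intrD st1.
    by rewrite mul1r.
  rewrite rpredD // rpredM ?intr_int //; apply: pure_coef_intM => //.
  by rewrite -Dx.
exists (map_poly numq f); rewrite Dx -map_in_alg_intr.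
congr (map_poly _ _).[_]; apply/polyP => i.
by rewrite coef_map coef_map_id0 //= numqK.
Qed.

Lemma Zbasis_pure (A : K -> Prop) : (forall x, A x <-> Zadjoin beta x) ->
  is_Zbasis (fun i : 'I_p => beta ^+ i) A.
Proof.
(* Only indices [i < p] occur, so [insub] always succeeds and the default [0] is never reached. *)
move=> ZA; pose ordpoly (c : 'I_p -> int) :=
  \poly_(i < p) oapp c 0 (insub i : option 'I_p).
have ordpolyE c :
    (map_poly intr (ordpoly c)).[beta] = \sum_(i < p) beta ^+ i *~ c i.
  rewrite (horner_coef_wide _ (leq_trans (size_poly _ _) (size_poly _ _))).
  by apply: eq_bigr => i _; rewrite coef_map coef_poly ltn_ord valK /= mulrzl.
split=> [x|c].
  rewrite ZA; split=> [/Zadjoin_pure_small[h szh ->]|[c ->]].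
    exists (fun i => h`_i).
    rewrite (horner_coef_wide _ (leq_trans (size_poly _ _) szh)).
    by apply: eq_bigr => i _; rewrite coef_map /= mulrzl.
  by exists (ordpoly c); rewrite ordpolyE.
rewrite -ordpolyE -map_in_alg_intr => /size_root_eq0 c0 i.
have := c0 (leq_trans (size_poly _ _) (size_poly _ _)).
move=> /(congr1 (fun g : {poly rat} => g`_i)).
rewrite coef_map coef_poly ltn_ord valK coef0 /= => /eqP.
by rewrite intr_eq0 => /eqP.
Qed.

Lemma monogenic_pure : (forall x : K, ring_of_integers x <-> Zadjoin beta x) ->
  monogenic K.
Proof.
move=> Zbeta; exists beta; first exact: integral_pure.
by rewrite dim_pure; apply: Zbasis_pure.
Qed.

End PureField.

(** * Arithmetic of the primes and the exponents *)

(** If [l ^ 2] divides the product, then [l] is some [q i]; after cancelling it, [l] divides the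
    remaining product and equals a second factor, against injectivity. *)
Lemma squarefree_prod_prime (m : nat) (q : 'I_m -> nat) :
  (forall i, prime (q i)) -> injective q -> squarefree (\prod_(i < m) q i).
Proof.
move=> q_prime q_inj l l_pr; apply/negP => l2N.
have : (l %| \prod_(i < m) q i)%N by apply: dvdn_trans l2N; rewrite dvdn_exp.
rewrite Euclid_dvd_prod // big_has => /hasP[i _].
rewrite dvdn_prime2 // => /eqP Dl.
move: l2N; rewrite (bigD1 i) //= -Dl expnS expn1 dvdn_pmul2l ?prime_gt0 //.
rewrite Euclid_dvd_prod // big_has_cond => /hasP[j _ /andP[ji]].
rewrite dvdn_prime2 // Dl => /eqP/q_inj Dj.
by rewrite Dj eqxx in ji.
Qed.

(** Both [u] and [u'] invert [e] modulo [p], and the range contains one representative of each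
    nonzero class; then [v] is determined. *)
Lemma bezout_small_uniq (p e u v u' v' : nat) :
  (0 < u < p)%N -> (0 < u' < p)%N ->
  e%:Z * u%:Z - p%:Z * v%:Z = 1 -> e%:Z * u'%:Z - p%:Z * v'%:Z = 1 ->
  u = u' /\ v = v'.
Proof.
move=> u_lt u'_lt Euv Euv'.
have Du : u%:Z - u'%:Z = p%:Z * (v%:Z * u'%:Z - v'%:Z * u%:Z).
  (* Each of [u] and [u'] is multiplied by the other's Bezout identity, so that the terms
     [e * u * u'] cancel. *)
  rewrite -[u%:Z in LHS]mul1r -[u'%:Z in LHS]mul1r -{1}Euv' -Euv; ring.
have Eu : u = u'.
  by move: Du; set t := (v%:Z * _ - _); case: (ltrgt0P t) => //; nia.
by split=> //; rewrite -Eu in Euv'; nia.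
Qed.

Lemma Zadjoin_sub (K : fieldExtType rat) (t x y : K) :
  Zadjoin t x -> Zadjoin t y -> Zadjoin t (x - y).
Proof. by move=> [f ->] [g ->]; exists (f - g); rewrite rmorphB !hornerE. Qed.

Lemma Zadjoin_exp (K : fieldExtType rat) (t x : K) n :
  Zadjoin (t ^+ n) x -> Zadjoin t x.
Proof.
move=> [f ->]; exists (f \Po 'X^n).
by rewrite map_comp_poly map_polyXn horner_comp hornerXn.
Qed.

Theorem proposition6p4
  (p : nat) (p_prime : prime p) (p_odd : odd p)
  (m : nat) (m_gt0 : (0 < m)%N)
  (q e : 'I_m -> nat)
  (q_prime : forall i, prime (q i)) (q_inj : injective q)
  (e_bounds : forall i, (1 <= e i <= p - 1)%N)
  (a : nat) (a_def : a = (\prod_(i < m) q i ^ e i)%N)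
  (K : fieldExtType rat) (alpha : K)
  (alpha_root : alpha ^+ p = a%:R)
  (K_gen : <<1; alpha>>%VS = {:K}%VS)
  (u v : 'I_m -> nat)
  (u_bounds : forall i, (1 <= u i <= p - 1)%N)
  (uv_bezout : forall i, (e i)%:Z * (u i)%:Z - p%:Z * (v i)%:Z = 1)
  (p_max : q_maximal p (Zadjoin alpha))
  (e_congr : forall i j, ~~ (p %| e i)%N -> ~~ (p %| e j)%N ->
               (e i = e j %[mod p])%N) :
  monogenic K /\
  (forall x : K, ring_of_integers x <->
     Zadjoin (alpha ^+ u (Ordinal m_gt0) / \prod_(i < m) (q i)%:R ^+ v i) x).
Proof.
have p_gt0 := prime_gt0 p_prime; set i0 := Ordinal m_gt0.
have e_lt i : (0 < e i < p)%N by have := e_bounds i; lia.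
have u_lt i : (0 < u i < p)%N by have := u_bounds i; lia.
(* Exponents strictly between [0] and [p] are prime to [p] and are their own residues, so the
   congruences become equalities. *)
have eE i : e i = e i0.
  have Ndvd j : ~~ (p %| e j)%N.
    by have /andP[e_gt0 e_ltp] := e_lt j; rewrite gtnNdvd.
  have := e_congr i i0 (Ndvd i) (Ndvd i0).
  by rewrite !modn_small //; [case/andP: (e_lt i0) | case/andP: (e_lt i)].
have vE i : v i = v i0.
  have := uv_bezout i; rewrite eE => bez.
  by have [] := bezout_small_uniq (u_lt i) (u_lt i0) bez (uv_bezout i0).
have bez : (e i0 * u i0 = p * v i0 + 1)%N by have := uv_bezout i0; lia.
under eq_bigr do rewrite vE; rewrite prodrXl -natr_prod.
move: (e i0) (u i0) (v i0) eE bez => e0 u0 v0 eE bez.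
set N := (\prod_(i < m) q i)%N.
have aE : a = (N ^ e0)%N.
  rewrite a_def (eq_bigr (fun i => q i ^ e0)%N) => [|i _]; last by rewrite eE.
  by apply/esym/(big_morph (expn^~ e0)) => [x y|]; rewrite ?exp1n // expnMn.
have N_gt0 : (0 < N)%N by apply: prodn_gt0 => i; apply: prime_gt0.
have N_gt1 : (1 < N)%N.
  apply: leq_trans (prime_gt1 (q_prime i0)) (dvdn_leq N_gt0 _).
  by rewrite /N (bigD1 i0) //= dvdn_mulr.
have sqfN : squarefree N by apply: squarefree_prod_prime.
have Nneq0 : N%:R != 0 :> K.
  by rewrite -(rmorph_nat (in_alg K)) fmorph_eq0 pnatr_eq0 -lt0n.
set beta := alpha ^+ u0 / _.
(* The exponent of [N] is [e0 * u0 - p * v0 = 1]. *)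
have beta_root : beta ^+ p = N%:R.
  rewrite expr_div_n exprAC alpha_root aE natrX -!exprM bez mulnC exprD expr1.
  by rewrite mulrAC divff ?mul1r ?expf_neq0.
(* Here [alpha ^+ (e0 * u0) = alpha * a ^+ v0], and [a ^+ v0 = N ^+ (e0 * v0)] cancels the
   denominator. *)
have alphaE : alpha = beta ^+ e0.
  rewrite expr_div_n -!exprM mulnC bez exprD expr1 exprM alpha_root aE natrX.
  by rewrite -exprM mulnC mulrAC divff ?mul1r ?expf_neq0.
have beta_gen : <<1; beta>>%VS = {:K}%VS.
  apply/eqP; rewrite eqEsubv subvf -K_gen; apply/FadjoinP; split.
    exact: subv_adjoin.
  by rewrite {1}alphaE rpredX ?memv_adjoin.
have [n O_index p_ndvd] := p_max.
have Zbeta := integral_pureP p_gt0 N_gt1 sqfN beta_root beta_gen.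
have {}Zbeta x : ring_of_integers x <-> Zadjoin beta x.
  apply: (Zbeta n) => [|y y_int]; first by rewrite coprime_sym prime_coprime.
  (* The index [n] multiplies [y] into [Z[alpha] = Z[beta ^+ e0]], which lies in [Z[beta]]. *)
  apply: (@Zadjoin_exp _ _ _ e0); rewrite -alphaE.
  apply: has_index_mulrn O_index y_int; last exact: Zadjoin_sub.
  exact: integral_add.
by split=> //; apply: (monogenic_pure p_gt0 N_gt1 sqfN beta_root beta_gen).
Qed.
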